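(* Let $m,n\in\mathbb{N}_+$ be positive integers. Then: 1) the inclusion $E^{[m]}\subset F^{[m]}_n$ implies $R(m)_n$; 2) the statement $R(m)_n$ implies $E^{[m]*}\subset F^{[m]}_n$; 3) the inclusion $E^{[m]}\subset F^{[m]}_n$ is equivalent to: for all positive integers $m'\le m$, $E^{[m']*}\subset F^{[m']}_n$; 4) the inclusion $E^{[m]}\subset F^{[m]}_n$ is equivalent to: for all positive integers $m'\le m$, $R(m')_n$ holds; 5) the inclusion $E^{[m]}\subset F^{[m]}_\cap$ is equivalent to: for all positive integers $m'\le m$, $R(m')$ holds.
   Context: $\mathbb{N}_+$ is the set of positive integers. For $m\in\mathbb{N}_+$, $\mathbb{C}^{[m]}=\mathbb{C}[X_1,\ldots,X_m]$, and $\mathcal{L}:\mathbb{C}^{[m]}\to\mathbb{C}$ is the $\mathbb{C}$-linear map with $\mathcal{L}(X_1^{l_1}\cdots X_m^{l_m})=l_1!\cdots l_m!$ for all integers $l_1,\ldots,l_m\ge 0$. For $f\in\mathbb{C}^{[m]}$, $\mathcal{N}(f)$ denotes the number of monomials appearing in $f$ with nonzero coefficient. For $n\in\mathbb{N}_+$, $$F_n^{[m]}=\{f\in\mathbb{C}^{[m]}\setminus\{0\}\,;\,\exists k\in\{n,\ldots,n+\mathcal{N}(f)-1\},\ \mathcal{L}(f^k)\ne 0\}\cup\{0\},\qquad F_\cap^{[m]}=\bigcap_{n\in\mathbb{N}_+}F_n^{[m]}.$$ Also $$E^{[m]}=\{X_1\cdots X_m(\mu_1X_1+\cdots+\mu_mX_m)\,;\,\mu_1,\ldots,\mu_m\in\mathbb{C}\},\qquad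 E^{[m]*}=\{f\in E^{[m]}\,;\,\mathcal{N}(f)=m\}.$$ For $m,n\in\mathbb{N}_+$, $R(m)_n$ is the following statement: for every polynomial $a(X)\in\mathbb{C}[X]$ of degree at most $m+1$ with $a(X)\equiv X$ mod $X^2$, if the coefficients of $X^{n+1},\ldots,X^{n+m}$ in the formal inverse (for composition of power series) $a^{-1}(X)$ all vanish, then $a(X)=X$. $R(m)$ is the statement that $R(m)_n$ holds for all $n\in\mathbb{N}_+$. *)

(* Defs.v *)
From HB Require Import structures.
From mathcomp Require Import all_boot all_order all_algebra.
From mathcomp Require Import complex ssrcomplements mpoly.
From mathcomp Require Import boolp classical_sets reals ring.

Set Implicit Arguments.
Unset Strict Implicit.
Unset Printing Implicit Defensive.

Import GRing.Theory.
Local Open Scope ring_scope.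
Local Open Scope classical_set_scope.

Section FactorialMap.
Variables (K : fieldType) (m : nat).
Implicit Types f : {mpoly K[m]}.

Definition Lfact f : K :=
  \sum_(u <- msupp f) f@_u * (\prod_(i < m) (u i)`!)%:R.

Lemma LfactE f d : (msize f <= d)%N ->
  Lfact f = \sum_(u : 'X_{1..m < d}) f@_u * (\prod_(i < m) (u i)`!)%:R.
Proof.
move=> led; rewrite /Lfact (big_mksub 'X_{1..m < d}) //=; last 2 first.
- exact: msupp_uniq.
- by move=> u uf; apply: leq_trans led; rewrite msize_mdeg_lt.
rewrite [RHS](bigID (fun u : 'X_{1..m < d} => val u \in msupp f)) /=.
rewrite [X in _ + X]big1 ?addr0 // => u /memN_msupp_eq0 ->.
by rewrite mul0r.
Qed.

Lemma Lfact_is_linear (c : K) f g : Lfact (c *: f + g) = c * Lfact f + Lfact g.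
Proof.
pose d := maxn (msize (c *: f + g)) (maxn (msize f) (msize g)).
rewrite !(@LfactE _ d) ?leq_max ?leqnn ?orbT // mulr_sumr -big_split /=.
by apply: eq_bigr => u _; rewrite mcoeffD mcoeffZ mulrDl mulrA.
Qed.

Lemma Lfact_monomial (u : 'X_{1..m}) :
  Lfact 'X_[u] = (\prod_(i < m) (u i)`!)%:R.
Proof. by rewrite /Lfact msuppX big_seq1 mcoeffX eqxx mul1r. Qed.

Definition nmonom f : nat := size (msupp f).

Definition Fset (n : nat) : set {mpoly K[m]} :=
  [set f | f != 0 /\
     exists k, (n <= k <= n + nmonom f - 1)%N /\ Lfact (f ^+ k) != 0]
  `|` [set 0].

Definition Fcap : set {mpoly K[m]} :=
  \bigcap_(n in [set n : nat | (0 < n)%N]) Fset n.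

Definition Eset : set {mpoly K[m]} :=
  [set f | exists mu : 'I_m -> K,
     f = (\prod_(i < m) 'X_i) * \sum_(i < m) mu i *: 'X_i].

Definition Estar : set {mpoly K[m]} := [set f : {mpoly K[m]} | Eset f /\ nmonom f = m].

End FactorialMap.

Arguments Fset K m n : clear implicits.
Arguments Fcap K m : clear implicits.
Arguments Eset K m : clear implicits.
Arguments Estar K m : clear implicits.

Section FormalInverse.
Variable K : fieldType.

(* A formal power series is its sequence of coefficients.  When g 0 = 0, the
   coefficient of X^n in f(g(X)) = \sum_i f_i g(X)^i only involves the terms
   with i <= n, and in them only the coefficients of g of index at most n. *)
Definition fps_comp (f g : nat -> K) (n : nat) : K :=
  \sum_(i < n.+1) f i * ((\poly_(j < n.+1) g j) ^+ i)`_n.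

Definition fpsX (n : nat) : K := (n == 1%N)%:R.

Definition fps_inverse (a b : nat -> K) : Prop :=
  [/\ b 0%N = 0, fps_comp a b = fpsX & fps_comp b a = fpsX].

Definition poly_fps (a : {poly K}) (n : nat) : K := a`_n.

Implicit Types p q r : {poly K}.

Let trunc (f : nat -> K) n : {poly K} := \poly_(j < n) f j.

Lemma dvdp_oppr p q : (p %| - q) = (p %| q).
Proof. by rewrite -sub0r dvdp_subr ?dvdp0. Qed.

Lemma dvdp_sub_trans p q r d : d %| p - q -> d %| q - r -> d %| p - r.
Proof. by move=> pq qr; rewrite -(subrKA q) dvdp_add. Qed.

Lemma dvdp_subC p q d : (d %| p - q) = (d %| q - p).
Proof. by rewrite -opprB dvdp_oppr. Qed.

Lemma comp_trunc f n p : trunc f n \Po p = \sum_(i < n) f i *: p ^+ i.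
Proof.
rewrite /trunc poly_def linear_sum; apply: eq_bigr => i _ /=.
by rewrite comp_polyZ rmorphXn /= comp_polyX.
Qed.

Lemma dvdXnP n p : reflect (forall i, (i < n)%N -> p`_i = 0) ('X^n %| p).
Proof.
apply: (iffP idP) => [/dvdpP[q ->] i lin|H]; first by rewrite coefMXn lin.
apply/dvdpP; exists (drop_poly n p); rewrite -[LHS](poly_take_drop n).
rewrite [take_poly n p](_ : _ = 0) ?add0r //.
by apply/polyP => i; rewrite coef_take_poly coef0; case: ifP => // /H.
Qed.

Lemma dvdX_comp_sub p q r : q - r %| (p \Po q) - (p \Po r).
Proof.
rewrite !comp_polyE -sumrB; apply: (big_ind (fun s => q - r %| s)).
- exact: dvdp0.
- by move=> s t; apply: dvdp_add.
- by move=> i _; rewrite -scalerBr -mul_polyC dvdp_mull // subrXX dvdp_mulIl.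
Qed.

Lemma dvdX_comp n p q : 'X %| q -> 'X^n %| p -> 'X^n %| p \Po q.
Proof.
move=> Xq /dvdpP[s ->]; rewrite comp_polyM rmorphXn /= comp_polyX dvdp_mull //.
exact: dvdp_exp2r.
Qed.

Lemma comp_cong n p p' q q' : 'X %| q ->
  'X^n %| p - p' -> 'X^n %| q - q' -> 'X^n %| (p \Po q) - (p' \Po q').
Proof.
move=> Xq pp qq; have -> : (p \Po q) - (p' \Po q')
  = ((p - p') \Po q) + ((p' \Po q) - (p' \Po q')).
  by rewrite comp_polyB addrA subrK.
by rewrite dvdp_add ?dvdX_comp // (dvdp_trans qq) // dvdX_comp_sub.
Qed.

Lemma dvdX_coef0 p : ('X %| p) = (p`_0 == 0).
Proof.
rewrite -['X]expr1; apply/dvdXnP/eqP => [->//|H [|i]//].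
Qed.

Lemma trunc_cong f n k : (n <= k)%N -> 'X^n %| trunc f k - trunc f n.
Proof.
move=> lek; apply/dvdXnP => i lin.
by rewrite coefB !coef_poly lin (leq_trans lin lek) subrr.
Qed.

Lemma fps_compE f g n i : g 0%N = 0 -> (i < n)%N ->
  fps_comp f g i = (trunc f n \Po trunc g n)`_i.
Proof.
move=> g0 lin.
have Xg k : 'X %| trunc g k by rewrite dvdX_coef0 coef_poly g0 if_same.
have /dvdXnP/(_ i (ltnSn i)) := comp_cong (Xg n) (trunc_cong f lin)
  (trunc_cong g lin).
rewrite coefB => /eqP; rewrite subr_eq0 => /eqP ->.
rewrite /fps_comp comp_trunc coef_sum.
by apply: eq_bigr => j _; rewrite coefZ.
Qed.

(* Successive approximations of the inverse of a = X + O(X^2). *)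
Fixpoint inv_approx (a : {poly K}) (k : nat) : {poly K} :=
  if k is k'.+1 then inv_approx a k' + ('X - (a \Po inv_approx a k')) else 0.

Lemma inv_approxP (a : {poly K}) k : a`_0 = 0 -> a`_1 = 1 ->
  'X %| inv_approx a k /\ 'X^(k.+1) %| 'X - (a \Po inv_approx a k).
Proof.
move=> a0 a1; elim: k => [|k [Xb Xe]] /=.
  rewrite dvdp0 comp_poly0r (_ : a`_0 = 0) // subr0.
  by rewrite expr1 dvdpp.
set b := inv_approx a k in Xb Xe *; set e := 'X - _ in Xe *.
have Xe1 : 'X %| e by apply: dvdp_trans Xe; rewrite exprS dvdp_mulIl.
have Xbe : 'X %| b + e by rewrite dvdp_add.
split=> //.
have : 'X^2 %| a - 'X.
  by apply/dvdXnP => -[|[|//]] _; rewrite coefB coefX ?a0 ?a1 subrr.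
case/dvdpP => c ca; pose d := c * 'X.
have aE : a = 'X + d * 'X.
  by rewrite /d -mulrA -expr2 -ca addrC subrK.
have Xd : 'X %| d by rewrite dvdp_mull.
have compE q : a \Po q = q + (d \Po q) * q.
  by rewrite aE comp_polyD comp_polyM comp_polyX.
have -> : 'X - (a \Po (b + e)) =
  - ((d \Po (b + e)) * e + ((d \Po (b + e)) - (d \Po b)) * b).
  by rewrite compE {1}/e compE; ring.
rewrite dvdp_oppr dvdp_add //.
  rewrite exprS dvdp_mul //.
  by rewrite -['X]expr1 dvdX_comp // expr1.
rewrite exprSr dvdp_mul //; apply: dvdp_trans Xe _.
by have := dvdX_comp_sub d (b + e) b; rewrite addrAC subrr add0r.
Qed.

Lemma dvdX_weak p n k : (n <= k)%N -> 'X^k %| p -> 'X^n %| p.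
Proof. by move=> nk /dvdXnP H; apply/dvdXnP => i /leq_trans/(_ nk)/H. Qed.

Lemma inv_approx_coef (a : {poly K}) n k : a`_0 = 0 -> a`_1 = 1 ->
  (n <= k)%N -> (inv_approx a k)`_n = (inv_approx a n)`_n.
Proof.
move=> a0 a1; elim: k => [|k IH]; first by rewrite leqn0 => /eqP ->.
rewrite leq_eqVlt => /orP[/eqP -> //|]; rewrite ltnS => nk.
rewrite -(IH nk) /= coefD.
have [_ /dvdXnP/(_ n) ->] := inv_approxP k a0 a1; last by rewrite ltnS.
by rewrite addr0.
Qed.

Lemma inv_approx_sub (a : {poly K}) k : a`_0 = 0 -> a`_1 = 1 ->
  'X^(k.+1) %| inv_approx a k - trunc (fun n => (inv_approx a n)`_n) k.+1.
Proof.
move=> a0 a1; apply/dvdXnP => i ik; rewrite coefB coef_poly ik.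
by rewrite inv_approx_coef ?subrr.
Qed.

(* The left-inverse half follows from the right-inverse one: if a(b) = X and
   b(c) = X then c = a(b(c)) = a. *)
Lemma fps_inverse_exists (a : {poly K}) : a`_0 = 0 -> a`_1 = 1 ->
  exists b, fps_inverse (poly_fps a) b.
Proof.
move=> a0 a1; pose b n := (inv_approx a n)`_n.
have b0 : b 0%N = 0 by rewrite /b coef0.
have Xa : 'X %| a by rewrite dvdX_coef0 a0.
have truncX f n : f 0%N = 0 -> 'X %| trunc f n.
  by move=> f0; rewrite dvdX_coef0 coef_poly f0 if_same.
have atr n : 'X^n %| trunc (poly_fps a) n - a.
  by apply/dvdXnP => i lin; rewrite coefB coef_poly lin subrr.
have right n : 'X^(n.+1) %| 'X - (a \Po trunc b n.+1).
  have [Xb Hb] := inv_approxP n a0 a1.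
  apply: dvdp_sub_trans Hb _.
  by rewrite comp_cong ?subrr ?dvdp0 ?inv_approx_sub.
exists b; split=> //; apply/funext => n; rewrite /fpsX -coefX.
  rewrite (fps_compE _ b0 (ltnSn n)); apply/eqP.
  rewrite -subr_eq0 -coefB; apply/eqP.
  apply/(dvdXnP n.+1); last exact: ltnSn.
  apply: (@dvdp_sub_trans _ (a \Po trunc b n.+1)); last by rewrite dvdp_subC.
  by rewrite comp_cong ?truncX ?subrr ?dvdp0.
rewrite (fps_compE _ a0 (ltnSn n)); apply/eqP.
rewrite -subr_eq0 -coefB; apply/eqP.
apply/(dvdXnP n.+1); last exact: ltnSn.
pose B := trunc b n.+2; pose T := trunc b n.+1.
have B0 : B`_0 = 0 by rewrite coef_poly.
have B1 : B`_1 = 1.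
  rewrite coef_poly /= /b /= comp_poly0r (_ : a`_0 = 0) //.
  by rewrite add0r subr0 coefX.
have [XC HC] := inv_approxP n B0 B1; set C := inv_approx B n in XC HC.
have XB : 'X %| B by rewrite dvdX_coef0 B0.
have CA : 'X^(n.+1) %| C - a.
  have H1 : 'X^(n.+1) %| (('X - (a \Po B)) \Po C).
    by rewrite dvdX_comp // (dvdX_weak _ (right n.+1)).
  have H2 : 'X^(n.+1) %| ((a \Po 'X) - (a \Po (B \Po C))).
    by apply: dvdp_trans HC _; apply: dvdX_comp_sub.
  have -> : C - a = (('X - (a \Po B)) \Po C)
     - ((a \Po 'X) - (a \Po (B \Po C))).
    by rewrite comp_polyB comp_polyX comp_polyXr comp_polyA; ring.
  by rewrite dvdp_sub.
have H3 : 'X^(n.+1) %| (T \Po trunc (poly_fps a) n.+1) - (B \Po C).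
  apply: comp_cong; first exact: truncX.
    by rewrite dvdp_subC trunc_cong.
  by apply: dvdp_sub_trans (atr n.+1) _; rewrite dvdp_subC.
by apply: dvdp_sub_trans H3 _; rewrite dvdp_subC.
Qed.

Lemma fps_inverse_unique (a b b' : nat -> K) : a 0%N = 0 ->
  fps_inverse a b -> fps_inverse a b' -> b = b'.
Proof.
move=> a0 [b0 _ ba] [b0' ab' _]; apply/funext => n.
have tr f g k : g 0%N = 0 -> fps_comp f g = fpsX ->
    'X^k %| (trunc f k \Po trunc g k) - 'X.
  move=> g0 fg; apply/dvdXnP => i ik.
  by rewrite coefB -(fps_compE _ g0 ik) fg coefX subrr.
set k := n.+1; pose A := trunc a k; pose B := trunc b k; pose B' := trunc b' k.
have XB' : 'X %| B' by rewrite dvdX_coef0 coef_poly /= b0'.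
have H1 : 'X^k %| (((B \Po A) - 'X) \Po B') by rewrite dvdX_comp ?tr.
have H2 : 'X^k %| (B \Po (A \Po B')) - (B \Po 'X).
  by apply: dvdp_trans (tr _ _ k b0' ab') _; apply: dvdX_comp_sub.
have : 'X^k %| B - B'.
  have -> : B - B' = (((B \Po A) - 'X) \Po B')
      - ((B \Po (A \Po B')) - (B \Po 'X)).
    by rewrite comp_polyB comp_polyX comp_polyXr comp_polyA; ring.
  by rewrite dvdp_sub.
move/dvdXnP/(_ n (ltnSn n))/eqP; rewrite coefB subr_eq0 !coef_poly ltnSn.
by move/eqP.
Qed.

(* fps_inverse_exists and fps_inverse_unique make b below denote the formal
   inverse of a. *)
Definition Rprop_at (m n : nat) : Prop :=
  forall a : {poly K}, (size a <= m.+2)%N -> a`_0 = 0 -> a`_1 = 1 ->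
  forall b : nat -> K, fps_inverse (poly_fps a) b ->
  (forall i, (n + 1 <= i <= n + m)%N -> b i = 0) -> a = 'X.

Definition Rprop (m : nat) : Prop := forall n, (0 < n)%N -> Rprop_at m n.

End FormalInverse.

(* Main.v *)
(* For f = X_1...X_m (mu_1 X_1 + ... + mu_m X_m), the multinomial theorem gives
   L(f^k) = k!^(m+1) [X^k] \prod_i (1 - mu_i X)^-(k+1), and by Lagrange inversion
   this coefficient is (k+1) [X^(k+1)] a^-1 for a = X \prod_i (1 - mu_i X).
   Over an algebraically closed field every a = X mod X^2 has this form, with
   the number of nonzero mu_i, which is N(f), equal to deg a - 1.  So all the
   statements compared say that, for certain lists s of nonzero scalars, some
   coefficient negbin_coef k s with k in a window of given length is nonzero. *)

From HB Require Import structures.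
Require Import Defs.
From mathcomp Require Import all_boot all_order all_algebra.
From mathcomp Require Import complex mpoly.
From mathcomp Require Import boolp classical_sets reals ring.

(** * Powers of (1 - x X)^-1 modulo X^n *)

Section NegativeBinomial.
Set Implicit Arguments.
Unset Strict Implicit.
Import GRing.Theory.
Local Open Scope ring_scope.
Variable K : fieldType.
Implicit Types (p q r : {poly K}) (x : K) (s : seq K).

Lemma coef_eqmodXn n p q i : 'X^n %| p - q -> (i < n)%N -> p`_i = q`_i.
Proof. by move=> /dvdXnP H /H /eqP; rewrite coefB subr_eq0 => /eqP. Qed.

Lemma eqmodXn_mul n p p' q q' :
  'X^n %| p - p' -> 'X^n %| q - q' -> 'X^n %| p * q - p' * q'.
Proof.
move=> pp qq; have -> : p * q - p' * q' = (p - p') * q + p' * (q - q') by ring.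
exact: dvdp_add (dvdp_mulr _ pp) (dvdp_mull _ qq).
Qed.

Lemma eqmodXn_exp n p q k : 'X^n %| p - q -> 'X^n %| p ^+ k - q ^+ k.
Proof.
move=> pq; elim: k => [|k IH]; first by rewrite !expr0 subrr dvdp0.
by rewrite !exprS eqmodXn_mul.
Qed.

Lemma dvdXn_deriv n p : 'X^(n.+1) %| p -> 'X^n %| p^`().
Proof.
by move=> /dvdXnP H; apply/dvdXnP => i lin; rewrite coef_deriv H ?mul0rn.
Qed.

(* The truncation of (1 - x X)^-(k+1) at order n. *)
Definition negbin n k x : {poly K} := \poly_(j < n) ('C(k + j, j)%:R * x ^+ j).

Lemma sum_bin_diag k i : (\sum_(j < i.+1) 'C(k + j, j) = 'C(k.+1 + i, i))%N.
Proof.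
elim: i => [|i IH]; first by rewrite big_ord1 !bin0.
by rewrite big_ord_recr /= IH addSnnS addSn binS addnC.
Qed.

(** Multiplication by (1 - x X)^-1 forms partial sums of coefficients, weighted by powers of x, so
    [sum_bin_diag] raises k by one. *)
Lemma negbin_exp n k x : 'X^n %| negbin n 0 x ^+ k.+1 - negbin n k x.
Proof.
elim: k => [|k IH]; first by rewrite expr1 subrr dvdp0.
rewrite exprSr; apply: dvdp_sub_trans (_ : _ %| negbin n k x * negbin n 0 x - _).
  by rewrite eqmodXn_mul ?subrr ?dvdp0.
apply/dvdXnP => i lin; rewrite coefB coefM coef_poly lin.
rewrite (eq_bigr (fun j : 'I_i.+1 => 'C(k + j, j)%:R * x ^+ i)); last first.
  move=> [j /= ji] _; rewrite !coef_poly (leq_ltn_trans _ lin) //.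
  rewrite (leq_ltn_trans (leq_subr _ _) lin) add0n binn mul1r -mulrA -exprD.
  by rewrite subnKC.
by rewrite -mulr_suml -natr_sum sum_bin_diag subrr.
Qed.

Lemma negbin0_inv n x : 'X^n %| (1 - x *: 'X) * negbin n 0 x - 1.
Proof.
apply/dvdXnP => i lin; rewrite mulrBl mul1r -scalerAl !coefB coefZ coefXM coef1.
case: i lin => [|i] lin; rewrite !coef_poly lin !add0n binn mul1r /=.
  by rewrite expr0 mulr0 subr0 subrr.
by rewrite ltnW // binn mul1r exprS subrr subr0.
Qed.

Lemma prod_negbin0_inv n s :
  'X^n %| (\prod_(x <- s) (1 - x *: 'X)) * (\prod_(x <- s) negbin n 0 x) - 1.
Proof.
rewrite -big_split /=; elim: s => [|x s IH]; first by rewrite big_nil subrr dvdp0.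
by rewrite big_cons -[X in _ - X]mulr1 eqmodXn_mul ?negbin0_inv.
Qed.

Lemma prod_negbin_exp n k s :
  'X^n %| (\prod_(x <- s) negbin n 0 x) ^+ k.+1 - \prod_(x <- s) negbin n k x.
Proof.
elim: s => [|x s IH]; first by rewrite !big_nil expr1n subrr dvdp0.
by rewrite !big_cons exprMn eqmodXn_mul ?negbin_exp.
Qed.

(** Truncation at order k+1 is the shortest that keeps the coefficient of X^k. *)
Definition negbin_coef k s : K := (\prod_(x <- s) negbin k.+1 k x)`_k.

Lemma negbin_coef_filter k s :
  negbin_coef k [seq x <- s | x != 0] = negbin_coef k s.
Proof.
rewrite /negbin_coef big_filter [in RHS](bigID (fun x => x != 0)) /=.
rewrite [X in _ * X]big1 ?mulr1 // => x /negPn/eqP ->.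
apply/polyP => j; rewrite coef_poly coef1.
by case: j => [|j]; rewrite ?bin0 ?mul1r // expr0n mulr0 if_same.
Qed.

End NegativeBinomial.

(** * Lagrange inversion *)

Section Lagrange.
Set Implicit Arguments.
Unset Strict Implicit.
Import GRing.Theory Num.Theory.
Local Open Scope ring_scope.
Variable K : numFieldType.
Implicit Types (P Q : {poly K}) (s : seq K).

(* With a = X P and Q = 1/P this is the residue of a' / a^(l+1), which vanishes
   for l > 0 because the integrand is then a derivative. *)
Lemma residue_deriv_exp n P Q l : 'X^n %| P * Q - 1 -> (l < n)%N ->
  (('X * P)^`() * Q ^+ l.+1)`_l = (l == 0%N)%:R.
Proof.
move=> PQ lin; rewrite derivM derivX mul1r mulrDl coefD -mulrA.
have -> : (P * Q ^+ l.+1)`_l = (Q ^+ l)`_l.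
  rewrite -[in RHS](mul1r (Q ^+ l)) exprS mulrA.
  by apply: coef_eqmodXn lin; rewrite eqmodXn_mul ?subrr ?dvdp0.
case: l lin => [|l] lin; first by rewrite expr0 coef1 coefXM addr0.
case: n PQ lin => // n PQ lin; apply/eqP.
(* After multiplication by l+1, both terms will be the coefficient of X^l in the derivative of
   Q^(l+1), up to sign. *)
rewrite -(mulrI_eq0 _ (@mulfI K l.+1%:R _)) ?pnatr_eq0 //.
(* Differentiating P Q = 1 replaces P' Q^2 by -Q'; the order lost is restored by the factor X. *)
have /dvdXn_deriv := PQ; rewrite derivB derivM derivC subr0 => PQ'.
have -> : ('X * (P^`() * Q ^+ l.+2))`_l.+1 = (- ('X * (Q^`() * Q ^+ l)))`_l.+1.
  apply: (coef_eqmodXn (n := n.+1)) => //.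
  have -> : 'X * (P^`() * Q ^+ l.+2) - - ('X * (Q^`() * Q ^+ l)) =
    'X * (P^`() * Q + P * Q^`()) * Q ^+ l.+1 - 'X * Q^`() * Q ^+ l * (P * Q - 1).
    by rewrite !exprS; ring.
  apply: dvdp_sub; last by rewrite dvdp_mull.
  by rewrite dvdp_mulr // exprS dvdp_mul.
rewrite coefN coefXM /= mulr_natl mulrnBl.
have := coef_deriv (Q ^+ l.+1) l; rewrite deriv_exp /= coefMn => ->.
by rewrite subrr.
Qed.

(** Differentiating b(a) = X gives b'(a) a' = 1. Multiply by Q^(k+1) and expand b'(a) in powers of a
    = X P: the residue computation kills every term but the one in a^k. *)
Lemma lagrange_inversion P Q (b : nat -> K) k : 'X^(k.+1) %| P * Q - 1 ->
  fps_inverse (poly_fps ('X * P)) b -> b k.+1 *+ k.+1 = (Q ^+ k.+1)`_k.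
Proof.
move=> PQ [_ _ ba]; set a := 'X * P in ba *.
pose B := \poly_(j < k.+2) b j.
have a0 : poly_fps a 0 = 0 by rewrite /poly_fps coefXM.
(* Order k+2, since the differentiation below loses one. *)
have Ba : 'X^(k.+2) %| (B \Po a) - 'X.
  pose A := \poly_(j < k.+2) poly_fps a j.
  have XA : 'X %| A by rewrite dvdX_coef0 coef_poly a0.
  apply: (@dvdp_sub_trans _ _ (B \Po A)).
    rewrite dvdp_subC comp_cong ?subrr ?dvdp0 //.
    by apply/dvdXnP => i ik; rewrite coefB coef_poly ik subrr.
  apply/dvdXnP => i ik.
  by rewrite coefB -(fps_compE _ a0 ik) ba coefX subrr.
have {}Ba : 'X^(k.+1) %| (B^`() \Po a) * a^`() - 1.
  by rewrite -deriv_comp -derivX -derivB dvdXn_deriv.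
have BE : B^`() = \poly_(i < k.+1) (b i.+1 *+ i.+1).
  apply/polyP => i; rewrite coef_deriv !coef_poly ltnS.
  by case: ifP => // _; rewrite mul0rn.
rewrite -[Q ^+ k.+1]mul1r.
have /coef_eqmodXn <- // : 'X^(k.+1) %|
    (B^`() \Po a) * a^`() * Q ^+ k.+1 - 1 * Q ^+ k.+1.
  by rewrite eqmodXn_mul ?subrr ?dvdp0.
(* As P Q = 1, the product a^i Q^(k+1) is X^i Q^(k-i+1), so [residue_deriv_exp] applies with l = k -
   i. *)
have res i : (i <= k)%N -> (a ^+ i * (a^`() * Q ^+ k.+1))`_k = (i == k)%:R.
  move=> ik; have lk : (k - i < k.+1)%N by rewrite ltnS leq_subr.
  have -> : a ^+ i * (a^`() * Q ^+ k.+1) =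
      'X^i * ((P * Q) ^+ i * (a^`() * Q ^+ (k - i).+1)).
    have -> : Q ^+ k.+1 = Q ^+ i * Q ^+ (k - i).+1 by rewrite -exprD addnS subnKC.
    by rewrite [a ^+ i]exprMn [(P * Q) ^+ i]exprMn -!mulrA (mulrCA a^`()).
  rewrite coefXnM ltnNge ik /=.
  have /coef_eqmodXn -> // : 'X^(k.+1) %|
      (P * Q) ^+ i * (a^`() * Q ^+ (k - i).+1) - 1 * (a^`() * Q ^+ (k - i).+1).
    rewrite eqmodXn_mul ?subrr ?dvdp0 // -[1](expr1n _ i).
    exact: eqmodXn_exp.
  by rewrite mul1r (residue_deriv_exp PQ lk) subn_eq0 eqn_leq ik.
rewrite BE comp_trunc -mulrA mulr_suml coef_sum (bigD1 ord_max) //=.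
rewrite -scalerAl coefZ res // eqxx mulr1 big1 ?addr0 // => i ni.
have ik : (i <= k)%N by rewrite -ltnS.
by rewrite -scalerAl coefZ res // (negPf (ni : i != k :> nat)) mulr0.
Qed.

Lemma lagrange_prod s (b : nat -> K) k :
  fps_inverse (poly_fps ('X * \prod_(x <- s) (1 - x *: 'X))) b ->
  b k.+1 *+ k.+1 = negbin_coef k s.
Proof.
move/(lagrange_inversion (prod_negbin0_inv k.+1 s)) ->.
exact: coef_eqmodXn (prod_negbin_exp k.+1 k s) (ltnSn k).
Qed.

End Lagrange.

(** * The factorial functional on a monomial times a power of a linear form *)

Section FactorialFunctional.
Set Implicit Arguments.
Unset Strict Implicit.
Import GRing.Theory.
Local Open Scope ring_scope.
Variables (K : fieldType) (m : nat).
Implicit Types (mu : 'I_m -> K) (s : seq 'I_m) (u : 'X_{1..m}).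

HB.instance Definition _ :=
  GRing.isLinear.Build K {mpoly K[m]} K *%R (@Lfact K m) (@Lfact_is_linear K m).

(* The exponents u are left free outside s so that the induction on s can absorb
   the powers of X_i coming from the binomial expansion into u. *)
Lemma Lfact_mul_exp_sum n k mu s u d : (d < n)%N -> uniq s ->
    {in s, forall i, u i = k} ->
  Lfact ('X_[u] * (\sum_(i <- s) mu i *: 'X_i) ^+ d) =
  (\prod_(i < m | i \notin s) (u i)`! * (d`! * k`! ^ size s))%:R
    * (\prod_(i <- s) negbin n k (mu i))`_d.
Proof.
elim: s u d => [|i s IH] u d dn /=.
  move=> _ _; rewrite !big_nil coef1 expr0n.
  case: d dn => [|d] dn; last by rewrite !mulr0 linear0.
  by rewrite !mulr1 muln1 Lfact_monomial.
case/andP=> nis us uk; have uik : u i = k by rewrite uk ?mem_head.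
rewrite !big_cons addrC exprDn mulr_sumr linear_sum coefM mulr_sumr.
apply: eq_bigr => -[j /= jd] _; rewrite ltnS in jd.
rewrite coef_poly (leq_ltn_trans jd dn).
have -> : 'X_[u] * ((\sum_(l <- s) mu l *: 'X_l) ^+ (d - j) * (mu i *: 'X_i) ^+ j
    *+ 'C(d, j)) = ('C(d, j)%:R * mu i ^+ j) *:
    ('X_[(u + U_(i) *+ j)] * (\sum_(l <- s) mu l *: 'X_l) ^+ (d - j)).
  rewrite exprZn mpolyXD -mpolyXn mulrnAr -!scalerAr -scaler_nat scalerA.
  by rewrite mulrA mulrAC.
rewrite linearZ /= IH ?(leq_ltn_trans (leq_subr _ _) dn) //; last first.
  move=> l ls; rewrite mnmDE mulmnE mnm1E uk ?inE ?ls ?orbT //.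
  by case: eqP ls nis => [-> ->|_ _ _]; rewrite ?addn0.
rewrite (bigD1 i) //= mnmDE mulmnE mnm1E eqxx mul1n uik.
rewrite (eq_bigl (fun l => l \notin i :: s)); last first.
  by move=> l; rewrite inE negb_or andbC.
rewrite [in LHS](eq_bigr (fun l => (u l)`!)); last first.
  move=> l; rewrite inE negb_or eq_sym => /andP[/negPf il _].
  by rewrite mnmDE mulmnE mnm1E il addn0.
set p := (\prod_(_ < _ | _) _)%N.
(* The factor (k+j)! comes from the new exponent of X_i; the identity trades it, with the binomial
   of the expansion, for the one in [negbin]. *)
have E : ('C(d, j) * ((k + j)`! * (d - j)`!) = d`! * k`! * 'C(k + j, j))%N.
  rewrite -(bin_fact jd) -(@bin_fact (k + j) j) ?leq_addl // addnK; ring.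
transitivity ((('C(d, j) * ((k + j)`! * (d - j)`!)) * (p * k`! ^ size s))%:R
    * (mu i ^+ j * (\prod_(l <- s) negbin n k (mu l))`_(d - j))).
  by rewrite !natrM; ring.
by rewrite E expnS !natrM; ring.
Qed.

End FactorialFunctional.

(** * Membership of E and E* in F_n, in terms of lists of nonzero scalars *)

Section EpolyFset.
Set Implicit Arguments.
Unset Strict Implicit.
Import GRing.Theory Num.Theory.
Local Open Scope ring_scope.
Local Open Scope classical_set_scope.
Variables (K : numFieldType) (m : nat).
Implicit Types (mu : 'I_m -> K) (s : seq K) (n k d : nat).

(** The window length d is independent of s: F_n calls for d = [size s], whereas R(m)_n calls for d
    = m. *)
Definition nonvanishing n d s : Prop :=
  exists2 k, (n <= k < n + d)%N & negbin_coef k s != 0.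

Definition Epoly mu : {mpoly K[m]} :=
  (\prod_(i < m) 'X_i) * \sum_(i < m) mu i *: 'X_i.

Definition nonzeros mu : seq K := [seq x <- codom mu | x != 0].

(** The monomials X_1...X_m X_i are pairwise distinct, so each nonzero mu_i contributes exactly
    one. *)
Lemma nmonom_Epoly mu : nmonom (Epoly mu) = size (nonzeros mu).
Proof.
pose F i : {mpoly K[m]} := mu i *: 'X_[\sum_(i < m) U_(i) + U_(i)].
have -> : Epoly mu = \sum_(i <- index_enum 'I_m) F i.
  rewrite /Epoly mprodXE mulr_sumr; apply: eq_bigr => i _.
  by rewrite /F mpolyXD scalerAr.
have supp i : msupp (F i) =
    if mu i != 0 then [:: (\sum_(i < m) U_(i) + U_(i))%MM] else [::].
  rewrite /F; case: eqP => [->|/eqP nz] /=; first by rewrite scale0r msupp0.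
  by rewrite msuppMCX.
rewrite /nmonom (perm_size (msupp_sum _ (index_enum_uniq _) _)); last first.
  move=> i j _ _ ij u /=; rewrite !supp.
  case: (mu i != 0) => //; case: (mu j != 0) => /=; last by rewrite andbF.
  rewrite !inE; apply/negP => /andP[/eqP -> /eqP /addmI /eqP].
  by rewrite eq_mnm1 (negPf ij).
rewrite size_flatten /shape -map_comp filter_predT size_filter count_map.
rewrite -sumn_count enumT; congr sumn; apply: eq_map => i /=.
by rewrite supp; case: (mu i != 0).
Qed.

(** This is [Lfact_mul_exp_sum] with all exponents of u equal to k, s the list of all indices and d
    = k. *)
Lemma Lfact_Epoly mu k : Lfact (Epoly mu ^+ k) =
  (k`! * k`! ^ m)%:R * negbin_coef k (codom mu).
Proof.
rewrite exprMn mprodXE mpolyXn (@Lfact_mul_exp_sum _ _ k.+1 k) //.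
- rewrite [index_enum _]unlock -enumT size_enum_ord big1 => [|i].
    by rewrite mul1n /negbin_coef /codom /image_mem [in RHS]big_map.
  by rewrite mem_enum.
- exact: index_enum_uniq.
move=> i _; rewrite mulmnE mnm_sumE (bigD1 i) //= mnm1E eqxx big1 ?mul1n //.
by move=> j /negPf ji; rewrite mnm1E ji.
Qed.

(** The factor k!^(m+1) is nonzero in characteristic 0, and the empty list stands for f = 0. *)
Lemma Fset_EpolyP mu n :
  Fset K m n (Epoly mu) <->
  nonzeros mu = [::] \/ nonvanishing n (size (nonzeros mu)) (nonzeros mu).
Proof.
have Ez : (Epoly mu == 0) = (nonzeros mu == [::]).
  by rewrite -msupp_eq0 -!size_eq0 -nmonom_Epoly.
(* For an empty list and n = 0, the truncated subtraction would admit k = 0 on the left only. *)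
have bound k : nonzeros mu != [::] ->
    (n <= k <= n + nmonom (Epoly mu) - 1)%N =
    (n <= k < n + size (nonzeros mu))%N.
  rewrite nmonom_Epoly; case: (nonzeros mu) => //= x s _.
  by rewrite addnS subn1.
have Lz k : (Lfact (Epoly mu ^+ k) != 0) = (negbin_coef k (nonzeros mu) != 0).
  rewrite Lfact_Epoly negbin_coef_filter mulf_eq0 pnatr_eq0 negb_or.
  by rewrite -lt0n muln_gt0 expn_gt0 fact_gt0.
split.
  case=> [[E0 [k [kn Lk]]]|/eqP]; last by rewrite Ez => /eqP; left.
  by right; exists k; rewrite -?Lz // -bound // -Ez.
have [nil _|nnil] := eqVneq (nonzeros mu) [::].
  by right; apply/eqP; rewrite Ez nil.
case=> [nil|[k kn ck]]; first by rewrite nil in nnil.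
left; split; first by rewrite Ez.
by exists k; rewrite Lz bound.
Qed.

(** Padding with 0, the default value of [nth], realises any short enough list of nonzero scalars by
    some mu; quantifiers over mu thus become quantifiers over lists. *)
Lemma nonzeros_nth s : 0 \notin s -> (size s <= m)%N ->
  nonzeros (fun i => nth 0 s i) = s.
Proof.
move=> s0 sm; rewrite /nonzeros /codom /image_mem (map_comp (nth 0 s)).
rewrite val_enum_ord -(subnKC sm) iotaD map_cat filter_cat map_nth_iota0 //.
rewrite take_size (all_filterP _); last by apply/allP => x; apply: contraTneq => ->.
rewrite (eq_in_filter (a2 := pred0)) ?filter_pred0 ?cats0 // => x.
case/mapP => j; rewrite mem_iota => /andP[sj _] ->.
by rewrite nth_default // eqxx.
Qed.

Lemma nonzeros_neq0 mu : 0 \notin nonzeros mu.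
Proof. by rewrite mem_filter eqxx. Qed.

Lemma size_nonzeros mu : (size (nonzeros mu) <= m)%N.
Proof.
by rewrite size_filter (leq_trans (count_size _ _)) // size_codom card_ord.
Qed.

Lemma Eset_subP n : Eset K m `<=` Fset K m n <->
  forall s, 0 \notin s -> (0 < size s <= m)%N -> nonvanishing n (size s) s.
Proof.
split=> [sub s s0 /andP[sgt0 sm]|H _ [mu ->]].
  have [] := (Fset_EpolyP (fun i => nth 0 s i) n).1 (sub _ (ex_intro _ _ erefl)).
    by rewrite nonzeros_nth // => nil; rewrite nil in sgt0.
  by rewrite nonzeros_nth.
apply/Fset_EpolyP; have [|nnil] := eqVneq (nonzeros mu) [::]; first by left.
right; apply: H; first exact: nonzeros_neq0.
by rewrite size_nonzeros lt0n size_eq0 nnil.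
Qed.

Lemma Estar_subP n : (0 < m)%N -> Estar K m `<=` Fset K m n <->
  forall s, 0 \notin s -> size s = m -> nonvanishing n m s.
Proof.
move=> m0; split=> [sub s s0 sm|H _ [[mu ->]]].
  have ms : nonzeros (fun i => nth 0 s i) = s by rewrite nonzeros_nth ?sm.
  have [] := (Fset_EpolyP (fun i => nth 0 s i) n).1 (sub _ _).
  - split; first by exists (fun i => nth 0 s i).
    by rewrite nmonom_Epoly ms.
  - by rewrite ms => nil; rewrite -sm nil in m0.
  - by rewrite ms sm.
rewrite nmonom_Epoly => sm; apply/Fset_EpolyP; right; rewrite sm.
by apply: H; first exact: nonzeros_neq0.
Qed.

End EpolyFset.

(** * R(m)_n in terms of lists of nonzero scalars *)

Section InverseCoefficients.
Set Implicit Arguments.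
Unset Strict Implicit.
Import GRing.Theory Num.Theory.
Local Open Scope ring_scope.
Variable K : numClosedFieldType.
Implicit Types (p : {poly K}) (r s : seq K).

Lemma prod_XsubC_inv r : 0 \notin r ->
  \prod_(z <- r) ('X - z%:P) =
  (\prod_(z <- r) - z) *: \prod_(x <- [seq z^-1 | z <- r]) (1 - x *: 'X).
Proof.
move=> r0; rewrite big_map -scaler_prod !big_seq; apply: eq_bigr => z zr.
have z0 : z != 0 by apply: contraNneq r0 => <-.
by rewrite scalerBr scalerA mulNr mulfV // scaleN1r opprK addrC scaleNr alg_polyC.
Qed.

Lemma size_prod_1subZX s : 0 \notin s ->
  size (\prod_(x <- s) (1 - x *: 'X)) = (size s).+1.
Proof.
move=> s0; have V0 : 0 \notin [seq x^-1 | x <- s].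
  by apply: contra s0 => /mapP[x xs /eqP]; rewrite eq_sym invr_eq0 => /eqP <-.
have := size_prod_XsubC [seq x^-1 | x <- s] id.
rewrite prod_XsubC_inv // (mapK (@invrK K)) size_map size_scale //.
rewrite prodf_seq_neq0; apply/allP => z zs /=.
by rewrite oppr_eq0; apply: contraNneq V0 => <-.
Qed.

Lemma coef0_prod_1subZX s : (\prod_(x <- s) (1 - x *: 'X))`_0 = 1.
Proof.
by rewrite -horner_coef0 horner_prod big1 // => x _; rewrite !hornerE subr0.
Qed.

(** Split p into linear factors: the constant term 1 excludes the root 0, so the roots can be
    inverted, and it forces the remaining scalar to be 1. *)
Lemma factor_1subZX p : p`_0 = 1 ->
  exists2 s, 0 \notin s & p = \prod_(x <- s) (1 - x *: 'X).
Proof.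
move=> p0; have [r pE] := closed_field_poly_normal p.
have r0 : 0 \notin r.
  apply/negP => zr; have : root p 0.
    rewrite pE rootZ ?root_prod_XsubC // lead_coef_eq0.
    by apply: contra_eq_neq p0 => ->; rewrite coef0 eq_sym oner_eq0.
  by rewrite /root horner_coef0 p0 oner_eq0.
exists [seq z^-1 | z <- r].
  by apply: contra r0 => /mapP[x xr /eqP]; rewrite eq_sym invr_eq0 => /eqP <-.
move: pE; rewrite prod_XsubC_inv // scalerA => pE; move: p0.
by rewrite [in LHS]pE coefZ coef0_prod_1subZX mulr1 => c1; rewrite pE c1 scale1r.
Qed.

(** Lists s correspond to a = X \prod_x (1 - x X) of degree [size s] + 1, with a = X for the empty
    list. By [lagrange_prod], the coefficients n+1, ..., n+m of the inverse vanish exactly when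
    [negbin_coef k s] does for n <= k < n+m. *)
Lemma Rprop_atP m n : Rprop_at K m n <->
  forall s, 0 \notin s -> (0 < size s <= m)%N -> nonvanishing n m s.
Proof.
split=> [Rmn s s0 /andP[sgt0 sm]|H a sa a0 a1 b ab bv].
  set P := \prod_(x <- s) (1 - x *: 'X).
  have P0 : P != 0 by rewrite -size_poly_eq0 size_prod_1subZX.
  have sa : size ('X * P) = (size s).+2.
    by rewrite size_mul ?polyX_eq0 // size_polyX size_prod_1subZX.
  have a0 : ('X * P)`_0 = 0 by rewrite coefXM.
  have a1 : ('X * P)`_1 = 1 by rewrite coefXM coef0_prod_1subZX.
  have [b ab] := fps_inverse_exists a0 a1.
  apply: contrapT => nv; suff aX : 'X * P = 'X.
    by move: sa; rewrite aX size_polyX => -[s0']; rewrite -s0' in sgt0.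
  apply: (Rmn _ _ a0 a1 b ab); rewrite ?sa //.
  case=> [|k]; rewrite !addn1 // => /andP[nk km].
  have := lagrange_prod k ab; have [-> /eqP|ck _] := eqVneq (negbin_coef k s) 0.
    by rewrite mulrn_eq0 => /eqP.
  by case: nv; exists k; rewrite // -ltnS nk.
(* [drop_poly 1 a] is a/X, whose constant term is 1. *)
have aE : a = 'X * drop_poly 1 a.
  rewrite -[LHS](poly_take_drop 1) mulrC expr1 (_ : take_poly 1 a = 0) ?add0r //.
  by apply/polyP => -[|i]; rewrite coef_take_poly coef0.
have [|s s0 sE] := @factor_1subZX (drop_poly 1 a); first by rewrite coef_drop_poly.
rewrite sE in aE; case: s => [|x s] in s0 sE aE *.
  by rewrite aE big_nil mulr1.
have szs : (0 < size (x :: s) <= m)%N.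
  rewrite /= -ltnS -[(size s).+2]/(size (x :: s)).+1 -size_prod_1subZX //.
  by rewrite -sE size_drop_poly leq_subLR.
have [k /andP[nk km]] := H _ s0 szs.
rewrite aE in ab; rewrite -(lagrange_prod k ab) bv ?mul0rn ?eqxx //.
by rewrite addn1 ltnS nk.
Qed.

End InverseCoefficients.

(** * Comparison of the E, E* and R statements *)

Local Open Scope complex_scope.
Local Open Scope classical_set_scope.

Theorem theorem2p25 (R : realType) (m n : nat) (hm : (0 < m)%N) (hn : (0 < n)%N) :
  (Eset R[i] m `<=` Fset R[i] m n -> Rprop_at R[i] m n) /\
  (Rprop_at R[i] m n -> Estar R[i] m `<=` Fset R[i] m n) /\
  (Eset R[i] m `<=` Fset R[i] m n <->
     forall m' : nat, (0 < m' <= m)%N -> Estar R[i] m' `<=` Fset R[i] m' n) /\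
  (Eset R[i] m `<=` Fset R[i] m n <->
     forall m' : nat, (0 < m' <= m)%N -> Rprop_at R[i] m' n) /\
  (Eset R[i] m `<=` Fcap R[i] m <->
     forall m' : nat, (0 < m' <= m)%N -> Rprop R[i] m').
Proof.
(* The window of length [size s] lies in the one of length m'. *)
have E_R N m' : (m' <= m)%N -> Eset R[i] m `<=` Fset R[i] m N ->
    Rprop_at R[i] m' N.
  move=> m'm /Eset_subP H; apply/Rprop_atP => s s0 /andP[sgt0 sm'].
  have [|k /andP[Nk kN] ck] := H s s0; first by rewrite sgt0 (leq_trans sm').
  by exists k; rewrite // Nk (leq_trans kN) // leq_add2l.
(* For lists of full length m' the two windows coincide. *)
have R_Estar N m' : (0 < m')%N -> Rprop_at R[i] m' N ->
    Estar R[i] m' `<=` Fset R[i] m' N.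
  move=> m'0 /Rprop_atP H; apply/Estar_subP => // s s0 sm'.
  by apply: H; rewrite ?sm' ?m'0 /=.
(* A list s is handled by the hypothesis at m' = [size s]. *)
have Estar_E N : (forall m' : nat, (0 < m' <= m)%N ->
    Estar R[i] m' `<=` Fset R[i] m' N) -> Eset R[i] m `<=` Fset R[i] m N.
  move=> H; apply/Eset_subP => s s0 sm; have /andP[sgt0 _] := sm.
  exact: (@Estar_subP _ _ N sgt0).1 (H _ sm) s s0 erefl.
split; first exact: E_R.
split; first exact: R_Estar.
split; first split=> [EF m' /andP[m'0 m'm]|].
- exact: R_Estar m'0 (E_R _ _ m'm EF).
- exact: Estar_E.
split; split.
- by move=> EF m' /andP[_ m'm]; apply: E_R.
- by move=> HR; apply: Estar_E => m' m'm; apply: R_Estar (HR _ m'm); case/andP: m'm.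
- move=> EF m' /andP[_ m'm] N N0; apply: E_R m'm _ => f Ef.
  exact: EF Ef N N0.
- move=> HR f Ef N N0; apply: (Estar_E N _ f Ef) => m' m'm.
  by apply: R_Estar (HR _ m'm _ N0); case/andP: m'm.
Qed.
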